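(* Let $d\in\mathbb{N}$ and let $K$ be a closed subset of $\mathbb{R}^d$. Then the following statements are equivalent: (i) Each linear functional $L:\mathbb{R}[x_1,\dots,x_d]\to\mathbb{R}$ is a general moment functional with representing signed measure supported by $K$. (ii) $K$ is Zariski dense in $\mathbb{R}^d$ and the linear space $\mathcal{N}_n(K)$ is finite-dimensional for each $n\in\mathbb{N}_0$.
   Context: A linear functional $L$ on $\mathbb{R}[x_1,\dots,x_d]$ is a general moment functional if there are (positive) Radon measures $\mu_1,\mu_2$ on $\mathbb{R}^d$ such that all polynomials are $\mu_1$- and $\mu_2$-integrable and $L(f)=\int f\,d\mu_1-\int f\,d\mu_2$ for all $f\in\mathbb{R}[x_1,\dots,x_d]$; then $\mu=\mu_1-\mu_2$ is called a representing signed measure of $L$. It is supported by $K$ (has support contained in $K$) if $\mathrm{supp}\,\mu_1\subseteq K$ and $\mathrm{supp}\,\mu_2\subseteq K$. $K\subseteq\mathbb{R}^d$ is Zariski dense if it is not contained in the zero set of any polynomial $p\in\mathbb{R}[x_1,\dots,x_d]$, $p\neq 0$. For $n\in\mathbb{N}_0$, $\mathcal{N}_n(K)$ is the real linear space of all $p\in\mathbb{R}[x_1,\dots,x_d]$ for which there exists a number $\lambda_p>0$ such that $|p(x)|\le\lambda_p(1+x_1^2+\cdots+x_d^2)^n$ for all $x\in K$. *)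

(* Defs.v *)
From HB Require Import structures.
From mathcomp Require Import all_boot all_order all_algebra.
(* The notations of mpoly clash with those of mathcomp-analysis. *)
From mathcomp Require Import -(notations) mpoly.
From mathcomp Require Import all_classical all_reals all_analysis.

Set Implicit Arguments.
Unset Strict Implicit.
Unset Printing Implicit Defensive.

Import Order.TTheory GRing.Theory Num.Theory.
Import numFieldNormedType.Exports.

Local Open Scope classical_set_scope.
Local Open Scope ring_scope.

(* R^d carries the product topology of its row-vector type (the library's
   sup-norm topology) and the Borel sigma-algebra, generated by the open
   sets. The type is convertible to 'rV[R]_d. *)
Notation borelRd R d := (g_sigma_algebraType (@open 'rV[R]_d)).

Notation realpoly R d := (mpoly.mpoly d R).

Section polynomials.
Context {R : realType} {d : nat}.
Implicit Types (K : set 'rV[R]_d) (p : realpoly R d).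

Definition peval p (x : 'rV[R]_d) : R := mpoly.meval (fun i => x ord0 i) p.

Definition zero_set p : set 'rV[R]_d := [set x | peval p x = 0].

Definition zariski_dense K : Prop :=
  ~ exists p, p != 0 /\ K `<=` zero_set p.

Definition growth_space (n : nat) K : set (realpoly R d) :=
  [set p | exists2 lambda : R, 0 < lambda &
    forall x, K x ->
      `|peval p x| <= lambda * (1 + \sum_(i < d) x ord0 i ^+ 2) ^+ n].

End polynomials.

(* V is meant to be a linear subspace of E; E itself need not be
   finite-dimensional, so V cannot be a {vspace E}. *)
Definition finite_dimensional {R : realType} {E : lmodType R} (V : set E)
    : Prop :=
  exists (m : nat) (b : 'I_m -> E),
    (forall i, V (b i)) /\
    (forall v, V v -> exists c : 'I_m -> R, v = \sum_(i < m) c i *: b i).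

Section measures.
Context {R : realType} {d : nat}.
Implicit Types (K : set 'rV[R]_d) (mu : {measure set borelRd R d -> \bar R}).

Definition radon mu : Prop :=
  (forall C : set 'rV[R]_d, compact C -> (mu C < +oo)%E) /\
  (forall A : set (borelRd R d), measurable A ->
     mu A = ereal_sup [set mu C | C in
       [set C : set 'rV[R]_d | compact C /\ C `<=` A]]).

(* Complement of the union of all open mu-null sets. *)
Definition measure_support mu : set 'rV[R]_d :=
  [set x | forall U : set 'rV[R]_d, open U -> U x -> (0 < mu U)%E].

Definition polynomials_integrable mu : Prop :=
  forall p : realpoly R d, mu.-integrable setT (EFin \o peval p).

Definition representing_signed_measure
    (L : {linear realpoly R d -> R^o})
    (mu1 mu2 : {measure set borelRd R d -> \bar R}) : Prop :=
  [/\ radon mu1, radon mu2,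
      polynomials_integrable mu1, polynomials_integrable mu2 &
      forall f : realpoly R d,
        L f = (\int[mu1]_x peval f x - \int[mu2]_x peval f x)%R].

Definition general_moment_functional_on K (L : {linear realpoly R d -> R^o})
    : Prop :=
  exists mu1 mu2 : {measure set borelRd R d -> \bar R},
    [/\ representing_signed_measure L mu1 mu2,
        measure_support mu1 `<=` K & measure_support mu2 `<=` K].

End measures.

(* Main.v *)
Require Import Defs.
From HB Require Import structures.
From mathcomp Require Import all_boot all_order all_algebra.
From mathcomp Require Import -(notations) mpoly.
From mathcomp Require Import all_classical all_reals all_analysis.
From mathcomp Require Import measurable_realfun.
From mathcomp Require Import ring lra.
Import Order.TTheory GRing.Theory Num.Theory.
Import numFieldNormedType.Exports.
Local Open Scope classical_set_scope.
Local Open Scope ring_scope.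

Set Implicit Arguments.
Unset Strict Implicit.
Unset Printing Implicit Defensive.

(** Write w_n for the weight (1 + |x|^2)^n and let e_0, e_1, ... be the
    monomials in some enumeration.

    Necessity.  If L is represented by mu_1 - mu_2 with both measures living
    on K, then |L p| <= C sup_K |p| / w_n with C the integral of w_n against
    mu_1 + mu_2 ([moment_functional_bounded]); so every linear functional is
    bounded on N_n(K) for the weighted sup norm.  A nonzero p vanishing on K
    would then be killed by all linear functionals, its own coefficients
    included.  If N_n(K) were infinite-dimensional, it would contain elements
    of weighted norm at most 1 whose leading index (last nonzero coefficient)
    takes arbitrarily large values k, and a triangular recursion gives a
    functional with value k on each of them, which is unbounded
    ([linear_of_triangular]).

    Sufficiency.  This is the theorem of Polya on infinite linear systems
    ([polya_infinite_system]).  One looks for atomic signed measures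
    s_0, s_1, ... carried by K, each finite, such that s_k annihilates e_j for
    j < k, the sum s_0 + ... + s_k takes the value L e_k on e_k, and s_k has
    w_n-mass at most 2^-k for every fixed n and all large k.  The sum of the
    s_k then has finite moments of all orders, and on every polynomial all but
    finitely many terms vanish, so that it represents L.

    By Hahn-Banach ([dominated_mod_span]) a finite measure annihilating the
    e_j with j < k, with prescribed value on e_k and arbitrarily small
    w_n-mass, exists as soon as no combination e_k - sum_(j < k) c_j e_j
    belongs to N_n(K).  When N_n(K) is finite-dimensional, the leading indices
    of its elements are bounded, so this holds for all large k
    ([basis_eventually_unbounded]).  For the finitely many remaining k it
    is enough that the e_j be linearly independent as functions on K, which is
    Zariski density. *)

(** * Finitely supported signed measures and infinite linear systems *)

Section atoms.
Context {R : realType} {X : choiceType}.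
Implicit Types (s : seq (R * X)) (f g w : X -> R) (K : set X).

(** A list of weighted points stands for the finitely supported signed measure
    with these atoms.  Points may be repeated, so that concatenation is the sum
    of measures; [mass] is the integral of a weight against the total variation
    when no point is repeated, and bounds it in general. *)
Definition pairing s f : R := \sum_(t <- s) t.1 * f t.2.
Definition mass s w : R := \sum_(t <- s) `|t.1| * w t.2.
Definition carried K s : Prop := forall t, t \in s -> K t.2.
Definition scale_atoms (c : R) s : seq (R * X) := [seq (c * t.1, t.2) | t <- s].

Lemma pairing_cat s1 s2 f : pairing (s1 ++ s2) f = pairing s1 f + pairing s2 f.
Proof. by rewrite /pairing big_cat. Qed.

Lemma mass_cat s1 s2 w :
  mass (s1 ++ s2) w = mass s1 w + mass s2 w.
Proof. by rewrite /mass big_cat. Qed.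

Lemma pairing_scale c s f : pairing (scale_atoms c s) f = c * pairing s f.
Proof.
by rewrite /pairing big_map mulr_sumr; apply: eq_bigr => t _; rewrite mulrA.
Qed.

Lemma mass_scale c s w : mass (scale_atoms c s) w = `|c| * mass s w.
Proof.
rewrite /mass big_map mulr_sumr; apply: eq_bigr => t _ /=.
by rewrite normrM mulrA.
Qed.

Lemma carried_cat K s1 s2 :
  carried K s1 -> carried K s2 -> carried K (s1 ++ s2).
Proof. by move=> h1 h2 t; rewrite mem_cat => /orP[/h1|/h2]. Qed.

Lemma carried_scale K c s : carried K s -> carried K (scale_atoms c s).
Proof. by move=> h _ /mapP[t ts ->]; exact: (h _ ts). Qed.

Lemma pairingD s f g : pairing s (fun x => f x + g x) = pairing s f + pairing s g.
Proof. by rewrite /pairing -big_split; apply: eq_bigr => t _; rewrite mulrDr. Qed.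

Lemma pairingZ s a f : pairing s (fun x => a * f x) = a * pairing s f.
Proof. by rewrite /pairing mulr_sumr; apply: eq_bigr => t _; rewrite mulrCA. Qed.

Lemma pairing_sum s n (a : nat -> R) (f : nat -> X -> R) :
  pairing s (fun x => \sum_(j < n) a j * f j x) =
  \sum_(j < n) a j * pairing s (f j).
Proof.
rewrite /pairing; under eq_bigr do rewrite mulr_sumr.
rewrite exchange_big; apply: eq_bigr => j _ /=; rewrite mulr_sumr.
by apply: eq_bigr => t _; rewrite mulrCA.
Qed.

Lemma le_mass K s w w' : carried K s -> (forall x, K x -> w x <= w' x) ->
  mass s w <= mass s w'.
Proof.
move=> sK ww'; rewrite /mass big_seq [leRHS]big_seq.
by apply: ler_sum => t /sK/ww' h; apply: ler_wpM2l.
Qed.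

Lemma mass_ge0 K s w : carried K s -> (forall x, K x -> 0 <= w x) ->
  0 <= mass s w.
Proof.
move=> sK ww'; rewrite /mass big_seq.
by apply: sumr_ge0 => t /sK/ww' h; apply: mulr_ge0.
Qed.

Definition annihilates (f : nat -> X -> R) m s : Prop :=
  forall j, (j < m)%N -> pairing s (f j) = 0.

(** A finite-dimensional Hahn-Banach theorem.  The hypothesis says that the
    functional defined by [g] on the measures annihilating the [f j] has norm at
    most [M]; its extensions to all measures are integration against
    [g - \sum_j c j * f j], and testing on point masses turns the norm bound
    into a pointwise one.  The induction removes one constraint at a time, the
    new coefficient [t] being chosen as in the one-step extension lemma. *)
Lemma dominated_mod_span K w (M : R) (f : nat -> X -> R) m g :
  (forall s, carried K s -> annihilates f m s ->
     `|pairing s g| <= M * mass s w) ->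
  exists c : nat -> R, forall x, K x ->
    `|g x - \sum_(j < m) c j * f j x| <= M * w x.
Proof.
elim: m g => [|m IH] g H.
  exists (fun=> 0) => x Kx; rewrite big_ord0 subr0.
  have := H [:: (1, x)]; rewrite /pairing /mass !big_seq1 /= normr1 !mul1r.
  by apply=> // t; rewrite inE => /eqP ->.
(* The numbers that the new coefficient has to dominate. *)
pose A := [set a : R | exists s, [/\ carried K s, annihilates f m s,
  pairing s (f m) = 1 & a = pairing s g - M * mass s w]].
(* Measures giving 1 to [f m] differ by one annihilating it, so the lower
   bounds imposed on the new coefficient stay below the upper bounds. *)
have crossed s s' : carried K s -> annihilates f m s -> pairing s (f m) = 1 ->
    carried K s' -> annihilates f m s' -> pairing s' (f m) = 1 ->
    pairing s g - M * mass s w <= pairing s' g + M * mass s' w.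
  move=> sK sf s1 s'K s'f s'1.
  have := H (s ++ scale_atoms (-1) s').
  rewrite !pairing_cat !mass_cat !pairing_scale !mass_scale.
  rewrite normrN1 !mul1r !mulN1r.
  have h1 : carried K (s ++ scale_atoms (-1) s').
    by apply: carried_cat => //; exact: carried_scale.
  have h2 : annihilates f m.+1 (s ++ scale_atoms (-1) s').
    move=> j; rewrite pairing_cat pairing_scale mulN1r ltnS leq_eqVlt.
    by move=> /orP[/eqP->|jm]; rewrite ?s1 ?s'1 ?subrr// sf// s'f// subrr.
  move=> /(_ h1 h2); rewrite ler_norml => /andP[_]; lra.
have [t Ht] : exists t, forall s, carried K s -> annihilates f m s ->
    pairing s (f m) = 1 -> `|pairing s g - t| <= M * mass s w.
  (* If no measure gives 1 to [f m], any coefficient will do. *)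
  have [A0|/set0P/negP/negPn/eqP A0] := pselect (A !=set0); last first.
    exists 0 => s sK sf s1; exfalso.
    suff : A (pairing s g - M * mass s w) by rewrite A0.
    by exists s.
  exists (sup A) => s sK sf s1; rewrite ler_distl; apply/andP; split.
    rewrite lerBlDr; apply: ge_sup; first exact: A0.
    by move=> _ [s' [s'K s'f s'1 ->]]; exact: crossed.
  rewrite -lerBlDr; apply: ub_le_sup; last by exists s.
  exists (pairing s g + M * mass s w) => _ [s' [s'K s'f s'1 ->]].
  exact: crossed.
(* By homogeneity the bound extends from [pairing s (f m) = 1] to all values. *)
have {}Ht s : carried K s -> annihilates f m s ->
    `|pairing s g - t * pairing s (f m)| <= M * mass s w.
  move=> sK sf; have [s0|s0] := eqVneq (pairing s (f m)) 0.
    rewrite s0 mulr0 subr0; apply: H => // j; rewrite ltnS leq_eqVlt.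
    by move=> /orP[/eqP->|]//; exact: sf.
  have := Ht (scale_atoms (pairing s (f m))^-1 s).
  rewrite !pairing_scale mulVf// mass_scale => /(_ _ _ erefl) H1.
  have {H1} : `|(pairing s (f m))^-1 * pairing s g - t| <=
      M * (`|(pairing s (f m))^-1| * mass s w).
    apply: H1; first exact: carried_scale.
    by move=> j /sf E; rewrite pairing_scale E mulr0.
  rewrite -(ler_pM2l (_ : 0 < `|pairing s (f m)|)) ?normr_gt0//.
  rewrite -normrM mulrBr mulVKf// mulrCA normfV mulVKf ?normr_eq0//.
  by rewrite [t * _]mulrC.
have [s sK sf|c Hc] := IH (fun x => g x + (- t) * f m x).
  rewrite pairingD pairingZ mulNr; exact: Ht.
exists (fun j => if j == m then t else c j) => x Kx.
rewrite big_ord_recr/= eqxx.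
have -> : \sum_(j < m) (if j == m :> nat then t else c j) * f j x =
    \sum_(j < m) c j * f j x.
  by apply: eq_bigr => j _; rewrite (ltn_eqF (ltn_ord j)).
by move: (Hc x Kx); congr (`|_| <= _); ring.
Qed.

Definition bounded_mod_span K w (f : nat -> X -> R) m g : Prop :=
  exists (c : nat -> R) (M : R), forall x, K x ->
    `|g x - \sum_(j < m) c j * f j x| <= M * w x.

(** The contrapositive of [dominated_mod_span]: measures with a fixed value at
    [g] can have arbitrarily small mass unless [g] is bounded modulo the
    span. *)
Lemma exists_small_dual K w (f : nat -> X -> R) m g (b eps : R) :
  (forall x, K x -> 0 <= w x) -> 0 < eps -> ~ bounded_mod_span K w f m g ->
  exists s, [/\ carried K s, annihilates f m s, pairing s g = b &
    mass s w <= eps].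
Proof.
move=> w0 eps0 unb.
have [s [sK sf sM]] : exists s, [/\ carried K s, annihilates f m s &
    `|b| / eps * mass s w < `|pairing s g|].
  apply: contrapT => noS; apply: unb.
  have [|c Hc] := @dominated_mod_span K w (`|b| / eps) f m g.
    by move=> s sK sf; rewrite leNgt; apply/negP => h; apply: noS; exists s.
  by exists c, (`|b| / eps).
have sg0 : 0 < `|pairing s g|.
  apply: le_lt_trans sM; rewrite mulr_ge0 ?divr_ge0 ?(ltW eps0)//.
  exact: mass_ge0 sK w0.
exists (scale_atoms (b / pairing s g) s); split.
- exact: carried_scale.
- by move=> j jm; rewrite pairing_scale sf// mulr0.
- by rewrite pairing_scale divfK// -normr_gt0.
- rewrite mass_scale normrM normfV mulrAC ler_pdivrMr//.
  by move: sM; rewrite mulrAC ltr_pdivrMr// => /ltW; rewrite [eps * _]mulrC.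
Qed.

(** For growing weights, being unbounded for one weight implies it for all
    smaller ones, so controlling the mass for the largest such weight controls
    it for all of them.  If there is no such weight, the zero weight is used:
    boundedness for it is linear dependence on [K]. *)
Lemma exists_graded_dual K (w : nat -> X -> R) (f : nat -> X -> R) k (b eps : R) :
  (forall n x, K x -> 0 <= w n x) ->
  (forall n n' x, (n <= n')%N -> K x -> w n x <= w n' x) ->
  (forall c : nat -> R, exists2 x, K x & f k x != \sum_(j < k) c j * f j x) ->
  0 < eps ->
  exists s, [/\ carried K s, annihilates f k s, pairing s (f k) = b &
    forall n, (n <= k)%N -> ~ bounded_mod_span K (w n) f k (f k) ->
      mass s (w n) <= eps].
Proof.
move=> w0 wmono indep eps0.
pose P n := (n <= k)%N && `[< ~ bounded_mod_span K (w n) f k (f k) >].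
have [[n0 Pn0]|noP] := pselect (exists n, P n).
  have Pk n : P n -> (n <= k)%N by case/andP.
  have exP : exists n, P n by exists n0.
  case: (ex_maxnP exP Pk) => n /andP[nk /asboolP unb] nmax.
  have [s [sK sf sb sn]] := exists_small_dual b (w0 n) eps0 unb.
  exists s; split => // n' n'k unb'; apply: le_trans sn.
  apply: (le_mass sK) => x Kx; apply: wmono => //; apply: nmax.
  by rewrite /P n'k; exact/asboolP.
have unb : ~ bounded_mod_span K (fun=> 0) f k (f k).
  case=> c [M cM]; have [x Kx] := indep c; rewrite -subr_eq0 -normr_le0.
  by have := cM x Kx; rewrite mulr0 => ->.
have [s [sK sf sb sn]] :=
  exists_small_dual b (fun _ _ => lexx 0) eps0 unb.
exists s; split => // n nk unbn; exfalso; apply: noP; exists n.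
by rewrite /P nk; exact/asboolP.
Qed.

(** Polya's theorem on infinite linear systems.  The k-th measure only has to
    correct the error left at [f k] by the previous ones, and it does so without
    disturbing the equations already solved. *)
Theorem polya_infinite_system K (w : nat -> X -> R) (f : nat -> X -> R)
    (b : nat -> R) :
  (forall n x, K x -> 0 <= w n x) ->
  (forall n n' x, (n <= n')%N -> K x -> w n x <= w n' x) ->
  (forall k (c : nat -> R),
     exists2 x, K x & f k x != \sum_(j < k) c j * f j x) ->
  exists s : nat -> seq (R * X), [/\ forall k, carried K (s k),
    forall k, annihilates f k (s k),
    forall k, \sum_(i < k.+1) pairing (s i) (f k) = b k &
    forall k n, (n <= k)%N -> ~ bounded_mod_span K (w n) f k (f k) ->
      mass (s k) (w n) <= (2^-1) ^+ k].
Proof.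
move=> w0 wmono indep.
have /choice[D HD] : forall kb : nat * R, exists s, [/\ carried K s,
    annihilates f kb.1 s, pairing s (f kb.1) = kb.2 &
    forall n, (n <= kb.1)%N -> ~ bounded_mod_span K (w n) f kb.1 (f kb.1) ->
      mass s (w n) <= (2^-1) ^+ kb.1].
  by move=> [k c] /=; apply: exists_graded_dual => //; rewrite exprn_gt0// invr_gt0.
(* [acc k] is the sum of the first [k] measures. *)
pose fix acc k := if k is k'.+1 then
  acc k' ++ D (k', b k' - pairing (acc k') (f k')) else [::].
pose s k := D (k, b k - pairing (acc k) (f k)).
have accE k g : pairing (acc k) g = \sum_(i < k) pairing (s i) g.
  elim: k => [|k IH]; first by rewrite big_ord0 /pairing big_nil.
  by rewrite big_ord_recr /= pairing_cat IH.
exists s; split=> k.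
- by have [] := HD (k, b k - pairing (acc k) (f k)).
- by have [] := HD (k, b k - pairing (acc k) (f k)).
- have [_ _ E _] := HD (k, b k - pairing (acc k) (f k)).
  by rewrite big_ord_recr -accE /s /= E /= addrC subrK.
- by have [] := HD (k, b k - pairing (acc k) (f k)).
Qed.

End atoms.

(** * Series of atomic measures *)

Section atomic_measure.
Context {R : realType} {disp : measure_display} {T : measurableType disp}.
Implicit Types (s : seq (R * T)) (f g : T -> R).

(** The positive part of a list of atoms; the negative part is the positive part
    of [scale_atoms (-1) s]. *)
Definition pos_atoms s : seq (R * T) := [seq (Num.max 0 t.1, t.2) | t <- s].

Lemma pairing_pos_atoms s f :
  pairing (pos_atoms s) f = \sum_(t <- s) Num.max 0 t.1 * f t.2.
Proof. by rewrite /pairing big_map. Qed.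

Lemma pairing_pos_sub_neg s f :
  pairing (pos_atoms s) f - pairing (pos_atoms (scale_atoms (-1) s)) f =
  pairing s f.
Proof.
rewrite !pairing_pos_atoms big_map -sumrB; apply: eq_bigr => t _ /=.
rewrite -mulrBl mulN1r; congr (_ * _).
by case: (lerP 0 t.1) => h; case: (lerP 0 (- t.1)) => h'; lra.
Qed.

Lemma pairing_pos_atoms_ge0 s f : (forall x, 0 <= f x) ->
  0 <= pairing (pos_atoms s) f.
Proof.
move=> f0; rewrite pairing_pos_atoms sumr_ge0// => t _.
by rewrite mulr_ge0// le_max lexx.
Qed.

Lemma pairing_pos_atoms_le_mass s f g : (forall x, 0 <= f x) ->
  (forall x, f x <= g x) -> pairing (pos_atoms s) f <= mass s g.
Proof.
move=> f0 fg; rewrite pairing_pos_atoms; apply: ler_sum => t _.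
apply: ler_pM => //; first by rewrite le_max lexx.
by rewrite ge_max normr_ge0 ler_norm.
Qed.

Fact pos_part_ge0 (a : R) : 0 <= Num.max 0 a.
Proof. by rewrite le_max lexx. Qed.

Fixpoint atom_sum s : {measure set T -> \bar R} :=
  if s is t :: s' then
    measure_add (mscale (NngNum (pos_part_ge0 t.1)) (dirac t.2)) (atom_sum s')
  else mzero.

Lemma integral_atom_sum s f : measurable_fun setT f -> (forall x, 0 <= f x) ->
  (\int[atom_sum s]_x (f x)%:E = (pairing (pos_atoms s) f)%:E)%E.
Proof.
move=> mf f0; have mEf : measurable_fun setT (EFin \o f) by exact/measurable_EFinP.
rewrite pairing_pos_atoms; elim: s => [|t s IH].
  by rewrite big_nil integral_measure_zero.
rewrite big_cons /=.
rewrite ge0_integral_measure_add//; last by move=> x _; rewrite lee_fin.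
rewrite IH ge0_integral_mscale//; last by move=> x _; rewrite lee_fin.
by rewrite integral_dirac//= diracT mul1e.
Qed.

Lemma atom_sumE s (A : set T) :
  atom_sum s A = (\sum_(t <- s) Num.max 0 t.1 * \1_A t.2)%:E.
Proof.
elim: s => [|t s IH]; first by rewrite big_nil.
by rewrite big_cons EFinD EFinM -IH; exact: measure_addE.
Qed.

Variable s : nat -> seq (R * T).

Definition atom_series : {measure set T -> \bar R} :=
  mseries (fun k => atom_sum (s k)) 0.

Lemma integral_atom_series f : measurable_fun setT f -> (forall x, 0 <= f x) ->
  (\int[atom_series]_x (f x)%:E =
   \sum_(k <oo) (pairing (pos_atoms (s k)) f)%:E)%E.
Proof.
move=> mf f0; rewrite ge0_integral_measure_series//; last 2 first.
  by move=> x _; rewrite lee_fin.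
  exact/measurable_EFinP.
by apply: eq_eseriesr => k _; rewrite integral_atom_sum.
Qed.

(** A bound on the masses for a weight [g] dominating [f] is all that is needed
    to control the integral of [f]; the same bound serves for the series of
    positive parts and for that of negative parts. *)
Lemma ge0_integral_atom_series_le f g B : measurable_fun setT f ->
  (forall x, 0 <= f x) -> (forall x, f x <= g x) ->
  (forall n, \sum_(k < n) mass (s k) g <= B) ->
  (\int[atom_series]_x (f x)%:E <= B%:E)%E.
Proof.
move=> mf f0 fg gB; rewrite integral_atom_series//.
apply: lime_le.
  by apply: is_cvg_nneseries => n _ _; rewrite lee_fin pairing_pos_atoms_ge0.
apply: nearW => n; rewrite sumEFin lee_fin big_mkord; apply: le_trans (gB n).
by apply: ler_sum => k _; exact: pairing_pos_atoms_le_mass.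
Qed.

Lemma integrable_atom_series f g B : measurable_fun setT f ->
  (forall x, `|f x| <= g x) ->
  (forall n, \sum_(k < n) mass (s k) g <= B) ->
  atom_series.-integrable setT (EFin \o f).
Proof.
move=> mf fg gB; apply/integrableP; split; first exact/measurable_EFinP.
apply: (@le_lt_trans _ _ B%:E); last by rewrite ltry.
apply: (ge0_integral_atom_series_le (f := fun x => `|f x|) _ _ fg gB) => //.
exact: measurableT_comp.
Qed.

Lemma cvg_ge0_Rintegral_atom_series f g B : measurable_fun setT f ->
  (forall x, 0 <= f x) -> (forall x, f x <= g x) ->
  (forall n, \sum_(k < n) mass (s k) g <= B) ->
  (fun n => \sum_(k < n) pairing (pos_atoms (s k)) f) @ \oo -->
    (\int[atom_series]_x f x)%R.
Proof.
move=> mf f0 fg gB.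
have fin : (\int[atom_series]_x (f x)%:E)%E \is a fin_num.
  rewrite ge0_fin_numE; last by apply: integral_ge0 => x _; rewrite lee_fin.
  apply: le_lt_trans (ge0_integral_atom_series_le mf f0 fg gB) _.
  by rewrite ltry.
have : (fun n => (\sum_(0 <= k < n) (pairing (pos_atoms (s k)) f)%:E)%E) @ \oo
    --> (\int[atom_series]_x (f x)%:E)%E.
  rewrite integral_atom_series//.
  by apply: is_cvg_nneseries => n _ _; rewrite lee_fin pairing_pos_atoms_ge0.
rewrite -(fineK fin) => /fine_cvg; apply: cvg_trans; apply: near_eq_cvg.
by apply: nearW => n /=; rewrite sumEFin big_mkord.
Qed.

Lemma cvg_Rintegral_atom_series f g B : measurable_fun setT f ->
  (forall x, `|f x| <= g x) ->
  (forall n, \sum_(k < n) mass (s k) g <= B) ->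
  (fun n => \sum_(k < n) pairing (pos_atoms (s k)) f) @ \oo -->
    (\int[atom_series]_x f x)%R.
Proof.
move=> mf fg gB.
have mp : measurable_fun setT (f^\+)%R by exact: measurable_funrpos.
have mn : measurable_fun setT (f^\-)%R by exact: measurable_funrneg.
have pg x : (f^\+)%R x <= g x.
  by apply: le_trans (fg x); rewrite /funrpos ge_max ler_norm normr_ge0.
have ng x : (f^\-)%R x <= g x.
  by apply: le_trans (fg x); rewrite /funrneg ge_max -normrN ler_norm normr_ge0.
have p0 x : 0 <= (f^\+)%R x by rewrite /funrpos le_max lexx orbT.
have n0 x : 0 <= (f^\-)%R x by rewrite /funrneg le_max lexx orbT.
have fE x : f x = (f^\+)%R x - (f^\-)%R x by rewrite -[in LHS](funrposBneg f).
have nneg x : `|(f^\-)%R x| <= g x by rewrite ger0_norm.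
have npos x : `|(f^\+)%R x| <= g x by rewrite ger0_norm.
have -> : (\int[atom_series]_x f x)%R =
    (\int[atom_series]_x (f^\+)%R x - \int[atom_series]_x (f^\-)%R x)%R.
  rewrite -RintegralB//; first by apply: eq_Rintegral => x _; exact: fE.
  - exact: integrable_atom_series gB.
  - exact: integrable_atom_series gB.
apply: cvg_trans (cvgB (cvg_ge0_Rintegral_atom_series mp p0 pg gB)
  (cvg_ge0_Rintegral_atom_series mn n0 ng gB)).
apply: near_eq_cvg; apply: nearW => n /=.
rewrite fctE -sumrB; apply: eq_bigr => k _.
rewrite !pairing_pos_atoms -sumrB; apply: eq_bigr => t _.
by rewrite -mulrBr -fE.
Qed.

Lemma atom_series_eq0 (A : set T) :
  (forall k t, t \in s k -> ~ A t.2) -> atom_series A = 0%E.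
Proof.
move=> sA; rewrite /atom_series /= /mseries eseries0// => k _ _.
rewrite atom_sumE big1_seq// => t /andP[_ /sA tA].
by rewrite indicE memNset// mulr0.
Qed.

End atomic_measure.

(** * Borel sets, Radon measures and supports *)

Section borel.
Context {R : realType} {d : nat}.
Implicit Types (K : set 'rV[R]_d) (p q : realpoly R d).
Implicit Types (mu : {measure set borelRd R d -> \bar R}).

Lemma open_measurable_borel (U : set 'rV[R]_d) :
  open U -> measurable (U : set (borelRd R d)).
Proof. by move=> oU; exact: sub_sigma_algebra. Qed.

Lemma closed_measurable_borel (C : set 'rV[R]_d) :
  closed C -> measurable (C : set (borelRd R d)).
Proof.
move=> cC; rewrite -[C]setCK; apply: measurableC; apply: open_measurable_borel.
exact: closed_openC.
Qed.

Lemma measurable_coord i :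
  measurable_fun setT (fun x : borelRd R d => (x : 'rV[R]_d) ord0 i).
Proof.
apply: (measurability _ (measurable_realfun.RGenOpens.measurableE R)).
move=> _ [_ [a [b ->] <-]]; rewrite setTI; apply: open_measurable_borel.
apply: open_comp; last exact: interval_open.
by move=> x _; exact: coord_continuous.
Qed.

Lemma measurable_peval p :
  measurable_fun setT (peval p : borelRd R d -> R).
Proof.
rewrite (_ : peval p = fun x => \sum_(m <- mpoly.msupp p)
   mpoly.mcoeff m p * \prod_(i < d) x ord0 i ^+ m i); last first.
  by apply/funext => x; exact: mpoly.mevalE.
apply: measurable_sum => m; apply: measurable_funM; first exact: measurable_cst.
apply: measurable_prod => i _; apply: measurable_funX; exact: measurable_coord.
Qed.

Section radon_atoms.
Variables (s : nat -> seq (R * borelRd R d)) (B : R).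
Hypothesis sB : forall n, \sum_(k < n) mass (s k) (fun=> 1) <= B.

Lemma atom_series_le (A : set (borelRd R d)) : (atom_series s A <= B%:E)%E.
Proof.
apply: lime_le.
  by apply: is_cvg_nneseries => n _ _; rewrite measure_ge0.
apply: nearW => n; rewrite (eq_bigr (fun k =>
  (\sum_(t <- s k) Num.max 0 t.1 * \1_A t.2)%:E)); last first.
  by move=> k _; rewrite atom_sumE.
rewrite sumEFin lee_fin big_mkord; apply: le_trans (sB n).
apply: ler_sum => k _; rewrite -pairing_pos_atoms.
apply: pairing_pos_atoms_le_mass => x; rewrite ?indicE//.
by case: (_ \in _).
Qed.

(** Finitely many terms of the series only see finitely many atoms, so the
    measure of a set is approached from inside by finite, hence compact, sets of
    atoms. *)
Lemma radon_atom_series : radon (atom_series s).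
Proof.
have mcpt (C : set 'rV[R]_d) : compact C -> measurable (C : set (borelRd R d)).
  move=> cC; apply: closed_measurable_borel; apply: compact_closed cC.
  exact: norm_hausdorff.
split=> [C _|A mA].
  by apply: le_lt_trans (atom_series_le C) _; rewrite ltry.
apply/eqP; rewrite eq_le; apply/andP; split; last first.
  apply: ub_ereal_sup => _ [C [cC CA] <-].
  by apply: le_measure => //; rewrite inE//; exact: mcpt.
apply: lime_le.
  by apply: is_cvg_nneseries => n _ _; rewrite measure_ge0.
apply: nearW => n.
pose C := [set x : 'rV[R]_d | A x /\ exists2 k : 'I_n, true & x \in map snd (s k)].
have finC : finite_set C.
  apply: (@sub_finite_set _ _ (\bigcup_(k in [set: 'I_n]) [set` map snd (s k)])).
    by move=> x [_ [k _ xk]]; exists k.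
  apply: bigcup_finite; first exact: finite_finset.
  by move=> k _; exact: finite_seq.
have cC : compact C by exact: finite_compact.
apply: (@le_trans _ _ (atom_series s C)); last first.
  by apply: ereal_sup_ubound; exists C => //; split => // x [].
rewrite (eq_big_nat _ _ (F2 := fun k => atom_sum (s k) C)).
  by apply: nneseries_lim_ge => k _ _; rewrite measure_ge0.
move=> k /andP[_ kn]; rewrite !atom_sumE; congr EFin.
apply: eq_big_seq => t ts; congr (_ * _); rewrite !indicE; congr ((nat_of_bool _)%:R).
apply/idP/idP; rewrite !inE /C /=; last by case.
move=> At; split => //; exists (Ordinal kn) => //=; exact: map_f.
Qed.

End radon_atoms.

Lemma atom_series_support K (s : nat -> seq (R * borelRd R d)) :
  closed K -> (forall k, carried K (s k)) ->
  measure_support (atom_series s) `<=` K.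
Proof.
move=> cK sK x xsupp; apply: contrapT => Kx.
suff E : atom_series s (~` K) = 0%E.
  by have := xsupp (~` K) (closed_openC cK) Kx; rewrite E ltxx.
by apply: atom_series_eq0 => k t ts; apply; exact: (sK k).
Qed.

(** Every compact subset of the complement of [K] is covered by finitely many
    open null sets, and inner regularity passes from compact sets to the
    complement itself. *)
Lemma support_null K mu : closed K -> radon mu -> measure_support mu `<=` K ->
  mu (~` K) = 0%E.
Proof.
move=> cK [_ inner] sK.
have mKC : measurable (~` K : set (borelRd R d)).
  by apply: open_measurable_borel; exact: closed_openC.
rewrite inner//; apply/eqP; rewrite eq_le; apply/andP; split; last first.
  by apply: ereal_sup_ubound; exists set0 => //; split => //; exact: compact0.
apply: ub_ereal_sup => _ [C [cC CK] <-].
have Cnull x : C x -> exists U : set 'rV[R]_d, [/\ open U, U x & mu U = 0%E].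
  move=> /CK Kx; apply: contrapT => noU; apply: Kx; apply: sK => U oU Ux.
  rewrite lt0e measure_ge0 andbT; apply/eqP => U0; apply: noU.
  by exists U.
have mC : measurable (C : set (borelRd R d)).
  apply: closed_measurable_borel; apply: compact_closed cC.
  exact: norm_hausdorff.
have {}cC : cover_compact C by rewrite -compact_cover.
have [|D DN CD] := cC _ [set U : set 'rV[R]_d | open U /\ mu U = 0%E] id
  (fun U => @proj1 _ _).
  by move=> x /Cnull[U [oU Ux U0]]; exists U.
suff : mu.-negligible (C : set (borelRd R d)) by move/measure_negligible => ->.
apply: (@negligibleS _ (borelRd R d) R mu _ _ CD); rewrite /cover bigcup_fset big_seq.
apply: big_ind; [exact: negligible_set0| |move=> U /DN].
  by move=> U V; exact: (@negligibleU _ (borelRd R d) R mu).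
rewrite inE => -[oU U0]; apply/negligibleP => //.
exact: open_measurable_borel.
Qed.

End borel.

(** * Vector spaces with a basis indexed by the natural numbers *)

(** A basis indexed by [nat], given together with its coordinate functionals.
    The last nonzero coordinate of a vector plays the part of its leading
    term. *)
Record sequence_basis (R : realType) (E : lmodType R) := SequenceBasis {
  basis_vec : nat -> E;
  basis_coord : E -> nat -> R;
  basis_coordP : forall a u v k,
    basis_coord (a *: u + v) k = a * basis_coord u k + basis_coord v k;
  basis_coord_vec : forall j k, basis_coord (basis_vec j) k = (j == k)%:R;
  basis_coord_finite : forall u,
    exists N, forall k, (N <= k)%N -> basis_coord u k = 0;
  basis_coord_expand : forall u N,
    (forall k, (N <= k)%N -> basis_coord u k = 0) ->
    u = \sum_(k < N) basis_coord u k *: basis_vec k }.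

Section sequence_basis_theory.
Context {R : realType} {E : lmodType R} (e : sequence_basis E).
Implicit Types (u v : E) (V : set E).

Definition below N u : Prop := forall k, (N <= k)%N -> basis_coord e u k = 0.

Lemma basis_coord0 k : basis_coord e 0 k = 0.
Proof.
have := basis_coordP e 1 0 0 k; rewrite scale1r addr0 mul1r => /eqP.
by rewrite -subr_eq subrr eq_sym => /eqP.
Qed.

Lemma basis_coordD u v k :
  basis_coord e (u + v) k = basis_coord e u k + basis_coord e v k.
Proof. by rewrite -[u]scale1r basis_coordP mul1r scale1r. Qed.

Lemma basis_coordZ a u k : basis_coord e (a *: u) k = a * basis_coord e u k.
Proof. by rewrite -[a *: u]addr0 basis_coordP basis_coord0 addr0. Qed.

Lemma basis_coord_sum n (F : 'I_n -> E) k :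
  basis_coord e (\sum_(i < n) F i) k = \sum_(i < n) basis_coord e (F i) k.
Proof.
apply: (big_morph (basis_coord e ^~ k)) => [u v|]; first exact: basis_coordD.
exact: basis_coord0.
Qed.

Lemma below_le N M u : (N <= M)%N -> below N u -> below M u.
Proof. by move=> NM uN k Mk; apply: uN; exact: leq_trans Mk. Qed.

Lemma exists_below2 u v : exists2 N, below N u & below N v.
Proof.
have [N uN] := basis_coord_finite e u; have [M vM] := basis_coord_finite e v.
exists (maxn N M); [apply: below_le uN|apply: below_le vM].
  exact: leq_maxl.
exact: leq_maxr.
Qed.

Lemma linear_of_values (beta : nat -> R) :
  exists L : {linear E -> R^o}, forall N u, below N u ->
    L u = \sum_(k < N) basis_coord e u k * beta k.
Proof.
pose bound u := projT1 (cid (basis_coord_finite e u)).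
have boundP u : below (bound u) u by rewrite /bound; case: cid.
pose L0 u : R^o := \sum_(k < bound u) basis_coord e u k * beta k.
have stable N M u : (N <= M)%N -> below N u ->
    \sum_(k < M) basis_coord e u k * beta k =
    \sum_(k < N) basis_coord e u k * beta k.
  move=> NM uN; rewrite -(subnKC NM) big_split_ord /= [X in _ + X]big1 ?addr0//.
  by move=> k _; rewrite uN ?mul0r// leq_addr.
have L0E N u : below N u -> L0 u = \sum_(k < N) basis_coord e u k * beta k.
  move=> uN; rewrite /L0; have [le|/ltnW le] := leqP N (bound u).
    exact: stable.
  by rewrite (stable _ _ _ le)//; exact: boundP.
have L0lin : linear L0.
  move=> a u v; have [N uN vN] := exists_below2 u v.
  have uvN : below N (a *: u + v).
    by move=> k Nk; rewrite basis_coordP uN// vN// mulr0 addr0.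
  rewrite !(L0E N)// scaler_sumr -big_split; apply: eq_bigr => k _ /=.
  by rewrite basis_coordP mulrDl -mulrA.
pose L : {linear E -> R^o} :=
  HB.pack L0 (GRing.isLinear.Build R E R^o _ L0 L0lin).
by exists L => N u uN; exact: L0E.
Qed.

(** Vectors whose leading index is [k], one for each [k], form a basis, so their
    images can be prescribed.  The values at the given basis are found by
    forward substitution. *)
Lemma linear_of_triangular (p : nat -> E) (t : nat -> R) :
  (forall k, basis_coord e (p k) k != 0) -> (forall k, below k.+1 (p k)) ->
  exists L : {linear E -> R^o}, forall k, L (p k) = t k.
Proof.
move=> pk0 pk.
pose F k (b : nat -> R) :=
  (t k - \sum_(j < k) basis_coord e (p k) j * b j) / basis_coord e (p k) k.
(* [acc n] holds the first [n] values of [beta], followed by zeros. *)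
pose fix acc n : nat -> R := if n is n'.+1 then
  fun j => if j == n' then F n' (acc n') else acc n' j else fun=> 0.
pose beta j := acc j.+1 j.
have accE n j : (j < n)%N -> acc n j = beta j.
  elim: n => // n IH; rewrite ltnS leq_eqVlt => /orP[/eqP->//|jn].
  by rewrite /= (ltn_eqF jn) IH.
have [L HL] := linear_of_values beta; exists L => k.
rewrite (HL _ _ (pk k)) big_ord_recr /= {2}/beta /= eqxx /F.
under [in X in _ + X]eq_bigr => j _ do rewrite accE//.
by rewrite mulrCA divff// mulr1 addrC subrK.
Qed.

(** Induction on the bound: either no vector of [V] has its last coordinate at
    [D], or any such vector completes a basis of the part of [V] below [D]. *)
Lemma finite_dimensional_of_below V D :
  (forall a u v, V u -> V v -> V (a *: u + v)) ->
  (forall v, V v -> below D v) -> finite_dimensional V.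
Proof.
elim: D V => [|D IH] V Vlin VD.
  exists 0, (fun=> 0); split=> [[]//|v /VD v0]; exists (fun=> 0).
  by rewrite (basis_coord_expand v0) !big_ord0.
have [|m [b [bV bspan]]] := IH (V `&` [set v | below D v]) _ (fun v => @proj2 _ _).
  move=> a u v [Vu uD] [Vv vD]; split; first exact: Vlin.
  by move=> k Dk; rewrite basis_coordP uD// vD// mulr0 addr0.
have [[u Vu uD]|noU] := pselect (exists2 u, V u & basis_coord e u D != 0); last first.
  exists m, b; split=> [i|v Vv]; first by have [] := bV i.
  apply: bspan; split=> // k; rewrite leq_eqVlt => /orP[/eqP <-|]; last exact: VD.
  by apply/eqP/negPn/negP => vD; apply: noU; exists v.
exists m.+1, (fun i => if unlift ord0 i is Some j then b j else u); split.
  by move=> i; case: unliftP => [j _|_]//; have [] := bV j.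
move=> v Vv; pose a := basis_coord e v D / basis_coord e u D.
have [|c cE] := bspan (- a *: u + v).
  split; first exact: Vlin.
  move=> k; rewrite basis_coordP leq_eqVlt => /orP[/eqP <-|Dk].
    by rewrite mulNr divfK// addNr.
  by rewrite (VD u)// (VD v)// mulr0 addr0.
exists (fun i => if unlift ord0 i is Some j then c j else a).
rewrite big_ord_recl unlift_none.
under eq_bigr => i _ do rewrite liftK.
by rewrite -cE scaleNr addrA subrr add0r.
Qed.

Lemma finite_dimensional_below V : finite_dimensional V ->
  exists D, forall v, V v -> below D v.
Proof.
move=> [m [b [_ bspan]]].
have /choice[N bN] : forall i, exists N, below N (b i).
  by move=> i; exact: basis_coord_finite.
exists (\max_(i < m) N i)%N => v /bspan[c ->] k Dk.
rewrite basis_coord_sum big1// => i _; rewrite basis_coordZ bN ?mulr0//.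
by apply: leq_trans Dk; exact: leq_bigmax.
Qed.

Lemma exists_leading_coord v k : basis_coord e v k != 0 ->
  exists n, [/\ (k <= n)%N, basis_coord e v n != 0 & below n.+1 v].
Proof.
move=> vk; have [N vN] := basis_coord_finite e v.
have ubN n : basis_coord e v n != 0 -> (n <= N)%N.
  by move=> vn; rewrite leqNgt; apply/negP => /ltnW/vN/eqP; exact/negP.
have exn : exists n, basis_coord e v n != 0 by exists k.
case: (ex_maxnP exn ubN) => n vn nmax; exists n; split=> //; first exact: nmax.
by move=> j nj; apply/eqP/negPn/negP => /nmax; rewrite leqNgt nj.
Qed.

End sequence_basis_theory.

(** * Polynomials and their growth *)

Lemma enumerate_multinom d : (0 < d)%N ->
  exists (phi : nat -> mpoly.multinom d) (idx : mpoly.multinom d -> nat),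
    cancel phi idx /\ cancel idx phi.
Proof.
move=> d0.
have inf : ~ finite_set [set: mpoly.multinom d].
  move=> fin; apply: infinite_nat.
  have : finite_set ((fun m : mpoly.multinom d => m (Ordinal d0)) @` setT).
    exact: finite_image.
  apply: sub_finite_set => n _.
  exists (mpoly.mnm_muln (mpoly.mnm1 (Ordinal d0)) n) => //.
  by rewrite mpoly.mulmnE mpoly.mnm1E eqxx mul1n.
have /card_set_bijP[idx] := eq_card_nat (countableP [set: mpoly.multinom d]) inf.
by rewrite setTT_bijective => -[phi phiK idxK]; exists phi, idx.
Qed.

Lemma mpoly_sequence_basis (R : realType) d : (0 < d)%N ->
  inhabited (sequence_basis (realpoly R d)).
Proof.
move=> d0; have [phi [idx [phiK idxK]]] := enumerate_multinom d0.
have basis_coordL (a : R) (u v : realpoly R d) k :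
    mpoly.mcoeff (phi k) (a *: u + v) =
    a * mpoly.mcoeff (phi k) u + mpoly.mcoeff (phi k) v.
  by rewrite mpoly.mcoeffD mpoly.mcoeffZ.
have vecE j k : mpoly.mcoeff (phi k) (mpoly.mpolyX R (phi j)) = (j == k)%:R :> R.
  by rewrite mpoly.mcoeffX (can_eq phiK).
have fin (u : realpoly R d) :
    exists N, forall k, (N <= k)%N -> mpoly.mcoeff (phi k) u = 0.
  exists (\max_(m <- mpoly.msupp u) (idx m).+1)%N => k Nk.
  apply: mpoly.memN_msupp_eq0; apply/negP => ku; move: Nk; rewrite leqNgt => /negP.
  apply; have := @leq_bigmax_seq _ _ xpredT (fun m => (idx m).+1) _ ku isT.
  by rewrite phiK.
have expand (u : realpoly R d) N :
    (forall k, (N <= k)%N -> mpoly.mcoeff (phi k) u = 0) ->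
    u = \sum_(k < N) mpoly.mcoeff (phi k) u *: mpoly.mpolyX R (phi k).
  move=> uN; apply/mpoly.mpolyP => m; rewrite -[m]idxK raddf_sum /=.
  under eq_bigr => k _ do rewrite mpoly.mcoeffZ vecE.
  have [mN|Nm] := ltnP (idx m) N; last first.
    rewrite uN// big1// => k _.
    by rewrite (ltn_eqF (leq_trans (ltn_ord k) Nm)) mulr0.
  rewrite (bigD1 (Ordinal mN))//= eqxx mulr1 big1 ?addr0// => k kN.
  by move: kN; rewrite -val_eqE /= => /negPf ->; rewrite mulr0.
exact: inhabits (SequenceBasis basis_coordL vecE fin expand).
Qed.

Section weights.
Context {R : realType} {d : nat}.
Implicit Types (p : realpoly R d) (x : 'rV[R]_d) (K : set 'rV[R]_d).

Definition weight n x : R := (1 + \sum_(i < d) x ord0 i ^+ 2) ^+ n.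

Definition weight_poly n : realpoly R d :=
  (1 + \sum_(i < d) mpoly.mpolyX R (mpoly.mnm1 i) ^+ 2) ^+ n.

Lemma peval_weight_poly n x : peval (weight_poly n) x = weight n x.
Proof.
rewrite /peval /weight_poly /weight rmorphXn rmorphD rmorph1 rmorph_sum.
congr ((1 + _) ^+ n); apply: eq_bigr => i _.
by rewrite rmorphXn /= mpoly.mevalXU.
Qed.

Lemma weight_base_ge1 x : 1 <= 1 + \sum_(i < d) x ord0 i ^+ 2.
Proof. by rewrite lerDl sumr_ge0// => i _; exact: sqr_ge0. Qed.

Lemma weight_ge0 n x : 0 <= weight n x.
Proof. by rewrite exprn_ge0// (le_trans ler01)// weight_base_ge1. Qed.

Lemma weight_mono n n' x : (n <= n')%N -> weight n x <= weight n' x.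
Proof. by move=> nn'; apply: ler_weXn2l => //; exact: weight_base_ge1. Qed.

Lemma pevalD p q x : peval (p + q) x = peval p x + peval q x.
Proof. exact: mpoly.mevalD. Qed.

Lemma pevalZ a p x : peval (a *: p) x = a * peval p x.
Proof. exact: mpoly.mevalZ. Qed.

Lemma peval_sum n (F : 'I_n -> realpoly R d) x :
  peval (\sum_(i < n) F i) x = \sum_(i < n) peval (F i) x.
Proof. exact: rmorph_sum. Qed.

Lemma peval_le_weight p :
  exists n lambda, 0 < lambda /\ forall x, `|peval p x| <= lambda * weight n x.
Proof.
exists (mpoly.mmeasure mpoly.mdeg p),
  (1 + \sum_(m <- mpoly.msupp p) `|mpoly.mcoeff m p|).
split; first by rewrite ltr_pwDl// sumr_ge0.
move=> x; rewrite /peval mpoly.mevalE mulrDl mul1r.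
apply: le_trans (ler_norm_sum _ _ _) _; apply: ler_wpDl; first exact: weight_ge0.
rewrite mulr_suml big_seq [leRHS]big_seq; apply: ler_sum => m mp.
rewrite normrM ler_wpM2l// normr_prod.
apply: (@le_trans _ _ (\prod_(i < d) weight (m i) x)).
  apply: ler_prod => i _; rewrite normr_ge0 normrX /=.
  apply: lerXn2r; rewrite ?nnegrE ?normr_ge0 ?(le_trans ler01 (weight_base_ge1 x))//.
  have h : `|x ord0 i| <= 1 + x ord0 i ^+ 2.
    rewrite ler_norml; apply/andP; split.
      by have := sqr_ge0 (x ord0 i + 1); have := sqr_ge0 (x ord0 i); nra.
    by have := sqr_ge0 (x ord0 i - 1); have := sqr_ge0 (x ord0 i); nra.
  apply: le_trans h _; rewrite lerD2l (bigD1 i)//= lerDl sumr_ge0// => j _.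
  exact: sqr_ge0.
rewrite prodrXr -mpoly.mdegE; apply: weight_mono; apply: ltnW.
exact: mpoly.msize_mdeg_lt.
Qed.

Lemma growth_space_linear n K a p q : growth_space n K p -> growth_space n K q ->
  growth_space n K (a *: p + q).
Proof.
move=> [l l0 pl] [l' l'0 ql]; exists (`|a| * l + l').
  by rewrite ltr_wpDl// mulr_ge0// ltW.
move=> x Kx; rewrite pevalD pevalZ mulrDl -mulrA.
apply: le_trans (ler_normD _ _) _; rewrite normrM lerD// ?ql//.
by rewrite ler_wpM2l// pl.
Qed.

(** Representable functionals are continuous for the weighted sup norms on [K],
    since the representing measures do not charge the complement of [K]. *)
Lemma moment_functional_bounded K (L : {linear realpoly R d -> R^o}) n :
  closed K -> general_moment_functional_on K L ->
  exists C, forall p lambda, 0 <= lambda ->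
    (forall x, K x -> `|peval p x| <= lambda * weight n x) ->
    `|L p| <= lambda * C.
Proof.
move=> cK [mu1 [mu2 [[r1 r2 i1 i2 LE] s1 s2]]].
have bound (mu : {measure set borelRd R d -> \bar R}) p lambda : radon mu ->
    polynomials_integrable mu -> measure_support mu `<=` K -> 0 <= lambda ->
    (forall x, K x -> `|peval p x| <= lambda * weight n x) ->
    `|\int[mu]_x peval p x| <= lambda * \int[mu]_x weight n x.
  move=> rmu imu smu lambda0 pK.
  have iW : mu.-integrable setT (EFin \o weight n).
    rewrite (_ : weight n = peval (weight_poly n)); first exact: imu.
    by apply/funext => x; rewrite peval_weight_poly.
  apply: le_trans (le_normr_Rintegral _ (imu p)) _ => //.
  rewrite -RintegralZl//; apply: fine_le.
  - apply: integrable_fin_num => //.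
    by have := integrable_norm (imu p).
  - apply: integrable_fin_num => //.
    exact: (integrableZl _ lambda iW).
  have mp := measurable_peval p.
  apply: ae_ge0_le_integral => //.
  - by apply/measurable_EFinP; exact: measurableT_comp.
  - by move=> x _; rewrite lee_fin mulr_ge0// weight_ge0.
  - apply/measurable_EFinP; apply: measurable_funM => //.
    by have /measurable_int/measurable_EFinP := iW.
  exists (~` K); split.
  - by apply: open_measurable_borel; exact: closed_openC.
  - exact: support_null.
  - move=> x /= xn Kx; apply: xn => _; rewrite lee_fin; exact: pK.
exists (\int[mu1]_x weight n x + \int[mu2]_x weight n x) => p lambda lambda0 pK.
rewrite LE mulrDr; apply: le_trans (ler_normB _ _) _.
by apply: lerD; exact: bound.
Qed.

End weights.

(** * The two implications *)

Lemma partial_sums_bounded (R : realType) (u : nat -> R) M :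
  (forall k, 0 <= u k) -> (forall k, (M <= k)%N -> u k <= (2^-1) ^+ k) ->
  exists B, forall n, \sum_(k < n) u k <= B.
Proof.
move=> u0 uM; exists (\sum_(k < M) u k + 2) => n.
apply: (@le_trans _ _ (\sum_(k < M + n) u k)).
  by rewrite addnC big_split_ord /= lerDl sumr_ge0.
rewrite big_split_ord /= lerD2l.
apply: (@le_trans _ _ (2 - 2 * (2^-1) ^+ n)); last first.
  by rewrite lerBlDr lerDl mulr_ge0.
elim: n => [|n IH]; first by rewrite big_ord0 expr0 mulr1 subrr.
rewrite big_ord_recr /= exprS mulVKf//.
have h : u (M + n)%N <= (2^-1) ^+ n.
  apply: le_trans (uM _ (leq_addr _ _)) _; rewrite exprD ler_piMl//.
  by rewrite exprn_ile1// invf_le1// ler1n.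
move: IH h; set a := _ ^+ n; lra.
Qed.

Section moment_problem.
Context {R : realType} {d : nat} (K : set 'rV[R]_d).
Hypothesis cK : closed K.
Variable e : sequence_basis (realpoly R d).

Let basis_fun k : 'rV[R]_d -> R := peval (basis_vec e k).

Section necessity.
Hypothesis moments :
  forall L : {linear realpoly R d -> R^o}, general_moment_functional_on K L.

(** If [p] vanishes on [K], its weighted norm is 0 and every functional kills
    it; but some coordinate of [p] is not 0. *)
Lemma moments_zariski_dense : zariski_dense K.
Proof.
move=> [p [p0 pK]].
have [k pk] : exists k, basis_coord e p k != 0.
  apply: contrapT => nok; move/eqP: p0; apply.
  rewrite (@basis_coord_expand _ _ e p 0) ?big_ord0// => k _.
  by apply/eqP/negPn/negP => pk; apply: nok; exists k.
have [L HL] := linear_of_values e (fun j => (j == k)%:R).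
have [C HC] := moment_functional_bounded 0 cK (moments L).
have Lp : L p = basis_coord e p k.
  have [N pN] := basis_coord_finite e p.
  have kN : (k < N)%N by rewrite ltnNge; apply/negP => /pN/eqP; exact/negP.
  rewrite (HL _ _ pN) (bigD1 (Ordinal kN))//= eqxx mulr1 big1 ?addr0// => j jk.
  by move: jk; rewrite -val_eqE /= => /negPf ->; rewrite mulr0.
have C0 l : 0 <= l -> `|L p| <= l * C.
  move=> l0; apply: HC => // x /pK ->.
  by rewrite normr0 mulr_ge0// weight_ge0.
have := C0 0 (lexx 0); rewrite mul0r normr_le0 Lp; exact/negP.
Qed.

(** Otherwise the unit ball of the weighted norm has elements with arbitrarily
    large leading index, and a functional taking the value [k] at one of leading
    index [k] whenever there is one cannot be bounded on that ball. *)
Lemma moments_growth_finite_dimensional n : finite_dimensional (growth_space n K).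
Proof.
suff [D HD] : exists D, forall v, growth_space n K v -> below e D v.
  by apply: finite_dimensional_of_below HD => a u v; exact: growth_space_linear.
apply: contrapT => noD.
have unb D : exists k, (D <= k)%N /\ exists v,
    [/\ basis_coord e v k != 0, below e k.+1 v &
      forall x, K x -> `|peval v x| <= 1 * weight n x].
  have [v [Vv [j [Dj vj]]]] : exists v, growth_space n K v /\
      exists j, (D <= j)%N /\ basis_coord e v j != 0.
    apply: contrapT => nov; apply: noD; exists D => v Vv k Dk.
    apply/eqP/negPn/negP => vk; apply: nov; exists v; split => //.
    by exists k.
  have [k [jk vk vbel]] := exists_leading_coord vj.
  exists k; split; first exact: leq_trans jk.
  case: Vv => l l0 vl; exists (l^-1 *: v); split.
  - by rewrite basis_coordZ mulf_neq0// invr_eq0 gt_eqF.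
  - by move=> i /vbel vi; rewrite basis_coordZ vi mulr0.
  - move=> x Kx; rewrite pevalZ normrM gtr0_norm ?invr_gt0// mul1r.
    by rewrite mulrC ler_pdivrMr// mulrC; exact: vl.
(* Indices that are not leading indices of the unit ball are filled with basis
   vectors to get a full triangular family. *)
have /choice[p pP] : forall k, exists v,
    [/\ basis_coord e v k != 0, below e k.+1 v &
    (exists v', [/\ basis_coord e v' k != 0, below e k.+1 v' &
      forall x, K x -> `|peval v' x| <= 1 * weight n x]) ->
    forall x, K x -> `|peval v x| <= 1 * weight n x].
  move=> k; have [[v [vk vb vK]]|nov] := pselect (exists v',
    [/\ basis_coord e v' k != 0, below e k.+1 v' &
      forall x, K x -> `|peval v' x| <= 1 * weight n x]).
    by exists v; split.
  exists (basis_vec e k); split=> //; first by rewrite basis_coord_vec eqxx oner_eq0.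
  by move=> j kj; rewrite basis_coord_vec (ltn_eqF kj).
have [L HL] := linear_of_triangular (fun k => k%:R)
  (fun k => let: And3 h _ _ := pP k in h)
  (fun k => let: And3 _ h _ := pP k in h).
have [C HC] := moment_functional_bounded n cK (moments L).
have [k [Ck vk]] := unb (Num.bound C).
have [_ _ /(_ vk) pK] := pP k.
have := HC _ _ ler01 pK; rewrite HL mul1r ger0_norm ?ler0n// leNgt => /negP; apply.
have [C0|C0] := ltP C 0; first by apply: lt_le_trans C0 _; rewrite ler0n.
by apply: lt_le_trans (archi_boundP C0) _; rewrite ler_nat.
Qed.

End necessity.

Section sufficiency.
Hypothesis dense : zariski_dense K.
Hypothesis findim : forall n, finite_dimensional (growth_space n K).

Lemma peval_basis_sum (c : nat -> R) k x :
  \sum_(j < k) c j * basis_fun j x = peval (\sum_(j < k) c j *: basis_vec e j) x.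
Proof. by rewrite peval_sum; apply: eq_bigr => j _; rewrite pevalZ. Qed.

Lemma coord_monic (c : nat -> R) k :
  basis_coord e (basis_vec e k - \sum_(j < k) c j *: basis_vec e j) k = 1.
Proof.
rewrite -scaleN1r addrC basis_coordP basis_coord_vec eqxx basis_coord_sum.
rewrite big1 ?mulr0 ?add0r//.
by move=> j _; rewrite basis_coordZ basis_coord_vec (ltn_eqF (ltn_ord j)) mulr0.
Qed.

Lemma basis_independent_on k (c : nat -> R) :
  exists2 x, K x & basis_fun k x != \sum_(j < k) c j * basis_fun j x.
Proof.
apply: contrapT => nox; apply: dense.
exists (basis_vec e k - \sum_(j < k) c j *: basis_vec e j); split.
  apply/eqP => E; have := coord_monic c k.
  by rewrite E basis_coord0 => /eqP; rewrite eq_sym oner_eq0.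
move=> x Kx; rewrite /zero_set /= -scaleN1r pevalD pevalZ mulN1r -peval_basis_sum.
by apply/eqP; rewrite subr_eq0; apply/negPn/negP => h; apply: nox; exists x.
Qed.

(** A bounded monic combination would be an element of the growth space with
    leading index [k], and these indices are bounded. *)
Lemma basis_eventually_unbounded n : exists D, forall k, (D <= k)%N ->
  ~ bounded_mod_span K (weight n) basis_fun k (basis_fun k).
Proof.
have [D HD] := finite_dimensional_below e (findim n).
exists D => k Dk [c [M cM]].
have : growth_space n K (basis_vec e k - \sum_(j < k) c j *: basis_vec e j).
  exists (`|M| + 1); first by rewrite ltr_wpDl.
  move=> x Kx; rewrite -scaleN1r pevalD pevalZ mulN1r -peval_basis_sum.
  apply: le_trans (cM x Kx) _; rewrite ler_wpM2r ?weight_ge0//.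
  by rewrite (le_trans (ler_norm M))// lerDl.
by move/HD => /(_ k Dk)/eqP; rewrite coord_monic oner_eq0.
Qed.

(** The representing measures are the sums of the positive and of the negative
    parts of the measures solving the infinite system in which the basis
    polynomials are prescribed the values of [L]. *)
Lemma moment_functional_of_finite_growth (L : {linear realpoly R d -> R^o}) :
  general_moment_functional_on K L.
Proof.
have [s [sK sann sval ssmall]] := @polya_infinite_system R _ K weight basis_fun
  (fun k => L (basis_vec e k)) (fun n x _ => weight_ge0 n x)
  (fun n n' x nn' _ => weight_mono x nn') basis_independent_on.
have mass_bound n : exists B, forall N, \sum_(k < N) mass (s k) (weight n) <= B.
  have [D HD] := basis_eventually_unbounded n.
  apply: (@partial_sums_bounded _ (fun k => mass (s k) (weight n)) (maxn n D)) => k.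
    by apply: (mass_ge0 (sK k)) => x _; exact: weight_ge0.
  by rewrite geq_max => /andP[nk /HD Dk]; exact: ssmall.
pose s' k := scale_atoms (-1) (s k).
have mass_s' k w : mass (s' k) w = mass (s k) w.
  by rewrite mass_scale normrN1 mul1r.
have mass_bound' n : exists B, forall N, \sum_(k < N) mass (s' k) (weight n) <= B.
  have [B HB] := mass_bound n; exists B => N.
  by under eq_bigr do rewrite mass_s'.
have w0 : weight 0 = (fun=> 1) :> ('rV[R]_d -> R).
  by apply/funext => x; rewrite /weight expr0.
have dominate p (t : nat -> seq (R * 'rV[R]_d)) :
    (forall n, exists B, forall N, \sum_(k < N) mass (t k) (weight n) <= B) ->
    exists g B, (forall x, `|peval p x| <= g x) /\
      (forall N, \sum_(k < N) mass (t k) g <= B).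
  move=> tB; have [n [l [l0 pl]]] := peval_le_weight p.
  have [B HB] := tB n; exists (fun x => l * weight n x), (l * B); split=> // N.
  have -> : \sum_(k < N) mass (t k) (fun x => l * weight n x) =
      l * \sum_(k < N) mass (t k) (weight n).
    rewrite mulr_sumr; apply: eq_bigr => k _; rewrite /mass mulr_sumr.
    by apply: eq_bigr => a _; rewrite mulrCA.
  by rewrite ler_pM2l.
exists (atom_series (s : nat -> seq (R * borelRd R d))),
  (atom_series (s' : nat -> seq (R * borelRd R d))); split; last 2 first.
- exact: atom_series_support.
- by apply: atom_series_support => // k; exact: carried_scale.
have rad (t : nat -> seq (R * 'rV[R]_d)) :
    (forall n, exists B, forall N, \sum_(k < N) mass (t k) (weight n) <= B) ->
    radon (atom_series (t : nat -> seq (R * borelRd R d))).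
  by move=> /(_ 0%N)[B]; rewrite w0 => tB; exact: radon_atom_series tB.
have int (t : nat -> seq (R * 'rV[R]_d)) :
    (forall n, exists B, forall N, \sum_(k < N) mass (t k) (weight n) <= B) ->
    polynomials_integrable (atom_series (t : nat -> seq (R * borelRd R d))).
  move=> tB p; have [g [B [pg gB]]] := dominate p t tB.
  exact: integrable_atom_series (measurable_peval p) pg gB.
split; [exact: rad|exact: rad|exact: int|exact: int|move=> p].
have [g [B [pg gB]]] := dominate p s mass_bound.
have gB' N : \sum_(k < N) mass (s' k) g <= B.
  by under eq_bigr do rewrite mass_s'.
have [J pJ] := basis_coord_finite e p.
have pE : peval p = fun x => \sum_(j < J) basis_coord e p j * basis_fun j x.
  by apply/funext => x; rewrite peval_basis_sum -basis_coord_expand.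
have cvg1 := cvg_Rintegral_atom_series (measurable_peval p) pg gB.
have cvg2 := cvg_Rintegral_atom_series (measurable_peval p) pg gB'.
apply: (cvg_unique (@Rhausdorff R) _ (cvgB cvg1 cvg2)).
(* The measures of index at least [J] annihilate [p]. *)
apply: cvg_near_cst; exists J => // N JN /=.
rewrite fctE -sumrB.
under eq_bigr do rewrite pairing_pos_sub_neg pE pairing_sum.
rewrite exchange_big /= {2}(basis_coord_expand pJ) linear_sum.
apply: eq_bigr => j _; rewrite linearZ -mulr_sumr; congr (_ * _).
rewrite -sval; have jN : (j.+1 <= N)%N by apply: leq_trans JN.
rewrite -(subnKC jN) big_split_ord /= [X in _ + X]big1 ?addr0// => k _.
by apply: sann; rewrite leq_addr.
Qed.

End sufficiency.
End moment_problem.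

Theorem theorem5 (R : realType) (d : nat) (hd : (0 < d)%N)
    (K : set 'rV[R]_d) (hK : closed K) :
  (forall L : {linear realpoly R d -> R^o}, general_moment_functional_on K L)
  <->
  (zariski_dense K /\
   forall n : nat, finite_dimensional (growth_space n K)).
Proof.
have [e] := mpoly_sequence_basis R hd.
split=> [moments|[dense findim] L].
  split=> [|n]; first exact: (moments_zariski_dense hK e moments).
  exact: (moments_growth_finite_dimensional hK e moments).
exact: (moment_functional_of_finite_growth hK e dense findim L).
Qed.
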